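(* (Pullback of the symmetric eigenvalue decomposition with distinct eigenvalues.) Given $A,Q,\Lambda,\bar Q,\bar\Lambda\in\mathbb{R}^{N\times N}$ with $\Lambda,Q=\mathrm{eigh}(A)$, where all eigenvalues $\lambda_1,\dots,\lambda_N$ (the diagonal entries of $\Lambda$) are distinct, one can compute $\bar A$ (the pullback of $(\bar\Lambda,\bar Q)$ through the symmetric eigenvalue decomposition) by $$H_{ij}=\begin{cases}(\lambda_j-\lambda_i)^{-1}&\text{if } i\neq j,\\ 0&\text{else,}\end{cases}\qquad \bar A=Q\bigl(\bar\Lambda+H\circ(Q^T\bar Q)\bigr)Q^T .$$
   Context: $\Lambda,Q=\mathrm{eigh}(A)$, for a symmetric matrix $A\in\mathbb{R}^{N\times N}$, denotes the functional dependence given by the defining equations $Q^TAQ=\Lambda$, $Q^TQ=I$ (the identity matrix), and all off-diagonal entries of $\Lambda$ are zero. $\circ$ is the elementwise product. Pullback is meant in the sense of the reverse mode of algorithmic differentiation: for $y=F(x)$ and given $\bar y$, the linear form $\sum_m\bar y_m\,\mathrm{d}y_m$ is rewritten as $\sum_n\bar x_n\,\mathrm{d}x_n$ with $\bar x_n=\sum_m\bar y_m\,\partial F_m/\partial x_n$. For the symmetric eigenvalue decomposition, with input $A$ and outputs $\Lambda,Q$, $\bar A$ is thus a matrix for which $\operatorname{tr}(\bar A^T\mathrm{d}A)=\operatorname{tr}(\bar\Lambda^T\mathrm{d}\Lambda)+\operatorname{tr}(\bar Q^T\mathrm{d}Q)$, where $\mathrm{d}\Lambda,\mathrm{d}Q$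 are the differentials of $\Lambda,Q$ as functions of the symmetric matrix $A$.
   Formalization: The formal statement additionally assumes that $\bar\Lambda$ is diagonal; for general $\bar\Lambda$ the formula fails, e.g. $N=2$, $A=\Lambda=\mathrm{diag}(1,2)$, $Q=I$, $\bar Q=0$, $\bar\Lambda$ with zero diagonal and off-diagonal entries 1. *)

(* Defs.v *)
From mathcomp Require Export all_boot all_order all_algebra.
From mathcomp Require Export all_classical all_reals all_analysis.
Export Order.TTheory GRing.Theory Num.Theory.
Export numFieldNormedType.Exports.

#[export] Set Implicit Arguments.
#[export] Unset Strict Implicit.
#[export] Unset Printing Implicit Defensive.

Local Open Scope classical_set_scope.
Local Open Scope ring_scope.

Definition hadamard (R : realType) (N : nat) (A B : 'M[R]_N) : 'M[R]_N :=
  map2_mx *%R A B.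

Definition is_eigh (R : realType) (N : nat) (A Lambda Q : 'M[R]_N) : Prop :=
  [/\ A^T = A, Q^T *m A *m Q = Lambda, Q^T *m Q = 1%:M & is_diag_mx Lambda].

(* Fréchet differential at A of a function of a symmetric matrix: increments
   range over the subspace of symmetric matrices only, so the values of [f] off
   that subspace, and those of [df] there, are irrelevant. *)
Definition sym_differential (R : realType) (N : nat) (f : 'M[R]_N -> 'M[R]_N)
    (A : 'M[R]_N) (df : {linear 'M[R]_N -> 'M[R]_N}) : Prop :=
  let sym0 := within [set E : 'M[R]_N | E^T = E] (nbhs (0 : 'M[R]_N)) in
  (fun E : 'M[R]_N => f (A + E) - f A - df E) =o_sym0 id.

(* The defining equations determine Lambda and Q only up to the order of the
   eigenvalues and the signs of the eigenvectors.  "Lambda and Q as functions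
   of the symmetric matrix A" are therefore local branches through the given
   (Lambda, Q), differentiable at A. *)
Definition eigh_branch (R : realType) (N : nat) (A Lambda Q : 'M[R]_N)
    (fL fQ : 'M[R]_N -> 'M[R]_N)
    (dL dQ : {linear 'M[R]_N -> 'M[R]_N}) : Prop :=
  [/\ fL A = Lambda /\ fQ A = Q,
      \forall B \near A, B^T = B -> is_eigh B (fL B) (fQ B),
      sym_differential fL A dL
    & sym_differential fQ A dQ].

(* The first conjunct says that the differentials of eigh at A exist; the second
   one that, whichever branch they come from, the trace identity holds. *)
Definition is_eigh_pullback (R : realType) (N : nat)
    (A Lambda Q Lambdabar Qbar Abar : 'M[R]_N) : Prop :=
  (exists fL fQ : 'M[R]_N -> 'M[R]_N,
     exists dL dQ : {linear 'M[R]_N -> 'M[R]_N},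
       eigh_branch A Lambda Q fL fQ dL dQ) /\
  (forall (fL fQ : 'M[R]_N -> 'M[R]_N)
          (dL dQ : {linear 'M[R]_N -> 'M[R]_N}),
     eigh_branch A Lambda Q fL fQ dL dQ ->
     forall dA : 'M[R]_N, dA^T = dA ->
       \tr (Abar^T *m dA) = \tr (Lambdabar^T *m dL dA) + \tr (Qbar^T *m dQ dA)).

(* Main.v *)
From HB Require Import structures.
Require Import Defs.
From mathcomp Require Import perm polyrcf ring lra.

(** Two things have to be shown: that a differentiable branch of the
    eigendecomposition passes through (Lambda, Q), and that every such branch
    satisfies the trace identity.

    Existence.  Conjugating by Q reduces to a perturbation Lambda + E of a
    diagonal matrix with distinct entries.  The characteristic polynomial of
    Lambda changes sign at each lambda_i, and its values depend continuously on
    the matrix, so for small E the intermediate value theorem gives an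
    eigenvalue mu_i of Lambda + E close to each lambda_i
    ([near_diag_eigenvalues]).  The mu_i are distinct and as many as the
    dimension, hence unit eigenvectors for them form an orthonormal basis as
    soon as E is symmetric ([sym_orthonormal_eigenrows]), and the eigenpairs
    come already labelled by i.  With the signs
    chosen so that the i-th component of the i-th eigenvector is nonnegative,
    the eigenvector equation read entrywise gives
    mu_i = lambda_i + E_ii + O(|E|^2) and the matrix of eigenvectors
    1 + H o E + O(|E|^2) ([eigenrow_estimates], [diag_eigh_expansion]).  Since
    differentiability is required at A only, any choice of such
    eigendecompositions, one for each nearby symmetric matrix, is a
    differentiable branch ([eigh_branch_exists]).

    Trace identity.  Along A + tE, the difference quotients at t -> 0 of
    Q^T Q = 1 and Q^T A Q = Lambda show that X = Q^T dQ is antisymmetric and that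
    dLambda = S + Lambda X - X Lambda is diagonal, where S = Q^T E Q.  Its
    off-diagonal entries give X = H o S and its diagonal entries
    dLambda = 1 o S ([eigh_branch_differentialE]).  Both differentials thus have
    the form E |-> P (H o (Q^T E Q)), whose adjoint for the trace pairing is
    X |-> Q (H o (P^T X)) Q^T ([mxtrace_masked_conj]); adding the two adjoints
    gives the formula for Abar. *)

Local Open Scope classical_set_scope.
Local Open Scope ring_scope.

(** * The maximum norm of a matrix *)

Lemma norm_mx_entry (R : realType) m n (M : 'M[R]_(m, n)) i j :
  `|M i j| <= `|M|.
Proof.
rewrite [leRHS]/Num.Def.normr /= mx_normrE.
by apply: (@le_bigmax _ _ _ _ (fun ij : 'I_m * 'I_n => `|M ij.1 ij.2|) (i, j)).
Qed.

Lemma norm_mx_le (R : realType) m n (M : 'M[R]_(m, n)) (c : R) :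
  0 <= c -> (forall i j, `|M i j| <= c) -> `|M| <= c.
Proof.
move=> c0 Mc; rewrite [leLHS]/Num.Def.normr /= mx_normrE.
by apply/bigmax_leP; split => // -[i j] _; exact: Mc.
Qed.

Lemma norm_mulmx_le (R : realType) m n p (M : 'M[R]_(m, n)) (P : 'M[R]_(n, p)) :
  `|M *m P| <= n%:R * `|M| * `|P|.
Proof.
apply: norm_mx_le => [|i j]; first by rewrite !mulr_ge0.
rewrite mxE; apply: (le_trans (ler_norm_sum _ _ _)).
rewrite -mulrA mulr_natl.
under eq_bigr do rewrite normrM.
apply: (@le_trans _ _ (\sum_(k < n) `|M| * `|P|)).
  by apply: ler_sum => k _; apply: ler_pM => //; exact: norm_mx_entry.
by rewrite sumr_const card_ord.
Qed.

(** * Eigenvalues near distinct diagonal entries *)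

Lemma horner_char_poly (R : comNzRingType) n (B : 'M[R]_n) x :
  (char_poly B).[x] = \det (x%:M - B).
Proof.
rewrite /char_poly -horner_evalE -det_map_mx; congr (\det _).
apply/matrixP => i j; rewrite !mxE -[LHS]/(horner _ _).
by rewrite hornerD hornerN hornerMn hornerX hornerC.
Qed.

Lemma continuous_char_poly (R : realType) n (x : R) :
  continuous (fun B : 'M[R]_n => (char_poly B).[x] : R).
Proof.
under eq_fun do rewrite horner_char_poly.
move=> B; rewrite /continuous_at /determinant.
apply: (@cvg_big _ _ +%R 0 xpredT add_continuous _ (nbhs B)) => s _.
apply: cvgM; first exact: cvg_cst.
apply: (@cvg_big R _ *%R 1 xpredT (@mul_continuous R) _ (nbhs B) _
  (fun i M => (x%:M - M) i (s i)) (fun i => (x%:M - B) i (s i))) => i _.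
under eq_fun do rewrite !mxE; rewrite !mxE.
by apply: cvgB; [exact: cvg_cst | exact: coord_continuous].
Qed.

(** The product of the values of the characteristic polynomial at L_ii - e and
    L_ii + e is negative for B = L, because the other roots lie outside the
    interval between them; by continuity it stays negative for B near L, and the
    intermediate value theorem applies. *)
Lemma near_diag_eigenvalues (R : realType) n (L : 'M[R]_n) (e : R) :
  is_diag_mx L -> 0 < e ->
  (forall i j, i != j -> e < `|L i i - L j j|) ->
  \forall B \near L, forall i,
    exists2 mu, `|mu - L i i| < e & eigenvalue B mu.
Proof.
move=> Ldiag e0 gap.
apply: (@filter_forall _ 'I_n (fun i B =>
  exists2 mu, `|mu - L i i| < e & eigenvalue B mu) (nbhs L)) => i.
pose a : R := L i i - e; pose b : R := L i i + e.
have lt0 : (char_poly L).[a] * (char_poly L).[b] < 0.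
  rewrite char_poly_trig ?is_diag_mx_is_trig// !horner_prod.
  rewrite -big_split /= (bigD1 i) //= !hornerE.
  have -> : (a - L i i) * (b - L i i) = - e ^+ 2 by rewrite /a /b; ring.
  rewrite mulNr oppr_lt0; apply: mulr_gt0; first exact: exprn_gt0.
  apply: prodr_gt0 => j ji.
  have := gap _ _ ji; rewrite !hornerE /a /b.
  rewrite -(ltr_pXn2r (ltn0Sn 1)) ?nnegrE ?normr_ge0 ?(ltW e0)//.
  rewrite real_normK ?num_real // => h.
  by rewrite [ltRHS](_ : _ = (L j j - L i i) ^+ 2 - e ^+ 2) ?subr_gt0//; ring.
have cvgp : (char_poly B).[a] * (char_poly B).[b] @[B --> L]
    --> (char_poly L).[a] * (char_poly L).[b].
  exact: (cvgM (@continuous_char_poly R n a L) (@continuous_char_poly R n b L)).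
apply: filterS (cvgr_lt _ cvgp _ lt0) => B /poly_ivtoo[].
  by rewrite /a /b; lra.
move=> mu; rewrite in_itv /= => /andP[amu mub] rmu; exists mu.
  by rewrite ltr_distl amu.
by rewrite eigenvalue_root_char.
Qed.

(** * Eigenvectors of a symmetric matrix with distinct eigenvalues *)

(** Eigenvectors of a symmetric matrix for distinct eigenvalues are orthogonal:
    both eigenvalues scale the same inner product.  The sign condition on the
    diagonal chooses between the two unit eigenvectors in each line, so that V is
    close to the identity when B is a small perturbation of a diagonal matrix and
    each mu_i is close to its i-th entry. *)
Lemma sym_orthonormal_eigenrows (R : realType) n (B : 'M[R]_n) (mu : 'rV[R]_n) :
  B^T = B -> (forall i j, i != j -> mu 0 i != mu 0 j) ->
  (forall i, eigenvalue B (mu 0 i)) ->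
  exists V : 'M[R]_n, [/\ V *m V^T = 1%:M, V *m B = diag_mx mu *m V
    & forall i, 0 <= V i i].
Proof.
move=> Bs mu_inj muP.
have /choice[v vP] : forall i, exists v : 'rV[R]_n,
    [/\ v *m B = mu 0 i *: v, (v *m v^T) 0 0 = 1 & 0 <= v 0 i].
  move=> i; have /eigenvalueP[v vB v0] := muP i.
  pose s := (v *m v^T) 0 0.
  have s_gt0 : 0 < s.
    rewrite /s mxE; under eq_bigr do rewrite mxE -expr2.
    rewrite lt_def sumr_ge0 ?andbT; last by move=> *; exact: sqr_ge0.
    apply: contra v0; rewrite psumr_eq0; last by move=> *; exact: sqr_ge0.
    move=> /allP h; apply/eqP/rowP => j; rewrite mxE; apply/eqP.
    by have := h j (mem_index_enum _); rewrite sqrf_eq0.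
  (* The sign makes the i-th coordinate of the unit vector nonnegative. *)
  pose r := (if 0 <= v 0 i then 1 else -1) / Num.sqrt s.
  exists (r *: v); split.
  - by rewrite -scalemxAl vB !scalerA mulrC.
  - rewrite linearZ -scalemxAl -scalemxAr !mxE -/s mulrA.
    have -> : \sum_j v 0 j * v^T j 0 = s by rewrite /s mxE.
    have r2 : r * r = s^-1.
      rewrite /r mulf_div -[X in _ / X]expr2 sqr_sqrtr ?(ltW s_gt0)//.
      by case: ifP => _; rewrite ?mulrNN mulr1 mul1r.
    by rewrite r2 mulVf ?gt_eqF.
  - rewrite mxE /r mulrAC divr_ge0 ?sqrtr_ge0//.
    by case: ifP => h; lra.
exists (\matrix_i v i); split.
- apply/matrixP => i j; rewrite !mxE.
  under eq_bigr do rewrite !mxE.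
  have dotE : \sum_k v i 0 k * v j 0 k = (v i *m (v j)^T) 0 0.
    by rewrite mxE; apply: eq_bigr => k _; rewrite mxE.
  rewrite dotE; have [<-|ij] := eqVneq i j; first by have [] := vP i.
  have [vi _ _] := vP i; have [vj _ _] := vP j.
  have : mu 0 i *: (v i *m (v j)^T) = mu 0 j *: (v i *m (v j)^T).
    by rewrite scalemxAl -vi -mulmxA -[in LHS]Bs -trmx_mul vj linearZ /= scalemxAr.
  move=> /matrixP/(_ 0 0); rewrite [LHS]mxE [RHS]mxE => h.
  have : (mu 0 i - mu 0 j) * (v i *m (v j)^T) 0 0 = 0 by rewrite mulrBl h subrr.
  by move=> /eqP; rewrite mulf_eq0 subr_eq0 (negbTE (mu_inj _ _ ij)) => /eqP.
- apply/row_matrixP => i; rewrite row_mul rowK.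
  rewrite row_mul row_diag_mx -scalemxAl -rowE rowK.
  by have [] := vP i.
- by move=> i; rewrite mxE; have [] := vP i.
Qed.

(** * Second-order expansion of the eigendecomposition *)

(** Entrywise, the equation V (L + E) = diag(mu) V reads
    V_ij (mu_i - L_jj) = (V E)_ij.  For i != j the gap makes V_ij = O(|E|);
    normalization of the rows then makes 1 - V_ii = O(|E|^2), so V E equals E up
    to O(|E|^2), and reading the same equation again with this sharper right-hand
    side yields the first-order terms.  The constant K depends on the size n and
    the gap e only, which is what makes the estimate uniform in E. *)
Lemma eigenrow_estimates (R : realType) n (e : R) :
  0 < e -> exists2 K : R, 0 <= K & forall (L E V : 'M[R]_n) (mu : 'rV[R]_n),
  is_diag_mx L -> (forall i j, i != j -> 3 * e <= `|L i i - L j j|) ->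
  `|E| <= 1 ->
  V *m V^T = 1%:M -> V *m (L + E) = diag_mx mu *m V ->
  (forall i, 0 <= V i i) -> (forall i, `|mu 0 i - L i i| <= e) ->
  [/\ forall i, `|mu 0 i - L i i - E i i| <= K * `|E| ^+ 2,
      forall i, `|V i i - 1| <= K * `|E| ^+ 2 &
      forall i j, i != j ->
        `|V i j - (L i i - L j j)^-1 * E i j| <= K * `|E| ^+ 2].
Proof.
move=> e0.
(* Up to powers of |E|: c bounds the off-diagonal entries of V, c1 those of
   V - 1, K1 the eigenvalue error, K2 the off-diagonal eigenvector error, and
   m * c ^+ 2 the diagonal one. *)
pose m : R := n%:R; pose c := m / (2 * e); pose c1 := c + m * c ^+ 2.
pose K1 := m * c1 + e * (m * c ^+ 2).
pose K2 := (m * c1 + c * (K1 + 1)) / (3 * e).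
have m0 : 0 <= m by exact: ler0n.
have c0 : 0 <= c by rewrite divr_ge0// mulr_ge0// ltW.
have mc0 : 0 <= m * c ^+ 2 by rewrite mulr_ge0// sqr_ge0.
have c10 : 0 <= c1 by rewrite addr_ge0.
have K10 : 0 <= K1 by apply: addr_ge0; apply: mulr_ge0 => //; exact: ltW.
have K20 : 0 <= K2.
  apply: divr_ge0; last by rewrite mulr_ge0// ltW.
  by apply: addr_ge0; apply: mulr_ge0 => //; exact: addr_ge0.
exists (m * c ^+ 2 + K1 + K2) => [|L E V mu Ldiag gap E1 VVt VLE V0 muL].
  by apply: addr_ge0 => //; exact: addr_ge0.
set k := `|E|; have k0 : 0 <= k by exact: normr_ge0.
have k20 : 0 <= k ^+ 2 by exact: sqr_ge0.
have Kle x : x <= (m * c ^+ 2) * k ^+ 2 \/ x <= K1 * k ^+ 2 \/ x <= K2 * k ^+ 2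
    -> x <= (m * c ^+ 2 + K1 + K2) * k ^+ 2.
  rewrite [(_ + K2) * _]mulrDl [(_ + K1) * _]mulrDl.
  move: (mulr_ge0 mc0 k20) (mulr_ge0 K10 k20) (mulr_ge0 K20 k20).
  move: (_ * _) (K1 * _) (K2 * _) => p q r ? ? ? [|[|]] ?; lra.
have row1 i : \sum_j V i j ^+ 2 = 1.
  have /matrixP/(_ i i) := VVt; rewrite !mxE eqxx mulr1n => <-.
  by apply: eq_bigr => j _; rewrite mxE expr2.
have V1 i j : `|V i j| <= 1.
  rewrite -(ler_pXn2r (ltn0Sn 1)) ?nnegrE// expr1n real_normK ?num_real//.
  rewrite -(row1 i) (bigD1 j)//= lerDl; apply: sumr_ge0 => *; exact: sqr_ge0.
have eigE i j : V i j * (mu 0 i - L j j) = (V *m E) i j.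
  have /matrixP/(_ i j) := VLE.
  rewrite mulmxDr mul_diag_mx [LHS]mxE [RHS]mxE.
  rewrite [(V *m L) i j]mxE (bigD1 j)//= big1 => [|l lj]; last first.
    by rewrite (is_diag_mxP Ldiag) ?mulr0.
  by move=> h; rewrite mulrBr [V i j * mu 0 i]mulrC -h addr0 addrAC subrr add0r.
have VE i j : `|(V *m E) i j| <= m * k.
  apply: (le_trans (norm_mx_entry _ _ _)); apply: (le_trans (norm_mulmx_le _ _)).
  rewrite -/m -/k ler_wpM2r// ler_piMr//; exact: norm_mx_le.
have ck0 : 0 <= c * k by exact: mulr_ge0.
have offdiag i j : i != j -> `|V i j| <= c * k.
  move=> ij; have gij := gap _ _ ij.
  have far : 2 * e <= `|mu 0 i - L j j|.
    have := ler_normB (mu 0 i - L j j) (mu 0 i - L i i).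
    have -> : mu 0 i - L j j - (mu 0 i - L i i) = L i i - L j j by ring.
    by have := muL i; lra.
  have := VE i j; rewrite -eigE normrM.
  rewrite /c mulrAC ler_pdivlMr ?mulr_gt0//; apply: le_trans.
  exact: ler_wpM2l.
(* As 0 <= V_ii <= 1, one has 1 - V_ii <= 1 - V_ii ^+ 2. *)
have diag i : `|V i i - 1| <= m * c ^+ 2 * k ^+ 2.
  have Vii : V i i <= 1 by have := V1 i i; rewrite ger0_norm.
  have : 1 - V i i ^+ 2 <= m * (c * k) ^+ 2.
    rewrite -{1}(row1 i) (bigD1 i)//= addrAC subrr add0r.
    apply: (@le_trans _ _ (\sum_(j < n) (c * k) ^+ 2)); last first.
      by rewrite sumr_const card_ord -[leLHS]mulr_natl.
    rewrite [leRHS](bigD1 i)//= -[leLHS]add0r; apply: lerD; first exact: sqr_ge0.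
    apply: ler_sum => j ji.
    rewrite -real_normK ?num_real// ler_pXn2r ?nnegrE ?ck0//.
    by apply: offdiag; rewrite eq_sym.
  rewrite exprMn mulrA distrC ger0_norm ?subr_ge0//; apply: le_trans.
  by rewrite lerD2l lerN2 expr2 ler_piMl.
have k2k : k ^+ 2 <= k by rewrite expr2 ler_piMl.
have near1 : `|V - 1%:M| <= c1 * k.
  apply: norm_mx_le => [|i j]; first exact: mulr_ge0.
  rewrite !mxE mulrDl; have [<-|ij] := eqVneq i j.
    apply: (le_trans (diag i)); apply: (le_trans (ler_wpM2l mc0 k2k)).
    by rewrite lerDr mulr_ge0.
  by rewrite subr0; apply: (le_trans (offdiag _ _ ij)); rewrite lerDl mulr_ge0.
pose D := (V - 1%:M) *m E.
have VED i j : (V *m E) i j = E i j + D i j.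
  by rewrite /D mulmxBl mul1mx [in RHS]mxE [X in _ = _ + (_ + X)]mxE addrC subrK.
have Dle i j : `|D i j| <= m * c1 * k ^+ 2.
  apply: (le_trans (norm_mx_entry _ _ _)); apply: (le_trans (norm_mulmx_le _ _)).
  rewrite -/m -/k expr2 mulrA ler_wpM2r// -mulrA ler_wpM2l//.
have muE i : `|mu 0 i - L i i - E i i| <= K1 * k ^+ 2.
  have -> : mu 0 i - L i i - E i i = D i i - (mu 0 i - L i i) * (V i i - 1).
    by rewrite mulrBr mulr1 [_ * V i i]mulrC eigE VED; ring.
  apply: (le_trans (ler_normB _ _)); rewrite [K1 * _]mulrDl; apply: lerD => //.
  by rewrite normrM -mulrA; apply: ler_pM.
split => [i|i|i j ij]; apply: Kle; [by right; left|by left|right; right].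
have gij := gap _ _ ij.
have Lij : L i i - L j j != 0 by rewrite -normr_gt0; lra.
(* The equation for V_ij carries the factor mu_i - L_jj; replacing mu_i by L_ii
   costs V_ij (mu_i - L_ii), a product of two terms of order |E|. *)
have -> : V i j - (L i i - L j j)^-1 * E i j =
    (D i j - V i j * (mu 0 i - L i i)) / (L i i - L j j).
  apply: (mulIf Lij); rewrite mulfVK// mulrBl mulrAC mulVf// mul1r.
  have := eigE i j; rewrite VED => h.
  have -> : D i j = V i j * (mu 0 i - L j j) - E i j by rewrite h; ring.
  ring.
rewrite normrM normfV /K2 mulrAC; apply: ler_pM => //.
  rewrite mulrDl; apply: (le_trans (ler_normB _ _)); apply: lerD => //.
  rewrite normrM expr2 mulrACA; apply: ler_pM => //; first exact: offdiag.
  have -> : mu 0 i - L i i = (mu 0 i - L i i - E i i) + E i i by ring.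
  apply: (le_trans (ler_normD _ _)); rewrite mulrDl mul1r; apply: lerD.
    by apply: (le_trans (muE i)); apply: ler_wpM2l.
  exact: norm_mx_entry.
by rewrite lef_pV2 ?posrE ?mulr_gt0//; lra.
Qed.

(** The factor 3 leaves room for moving each of two entries by e while keeping
    them e apart. *)
Lemma uniform_gap (R : realType) n (l : 'I_n -> R) :
  (forall i j, i != j -> l i != l j) ->
  exists2 e : R, 0 < e & forall i j, i != j -> 3 * e <= `|l i - l j|.
Proof.
move=> l_inj.
pose g := \big[Num.min/1]_(p : 'I_n * 'I_n | p.1 != p.2) `|l p.1 - l p.2|.
exists (g / 3) => [|i j ij].
  rewrite divr_gt0//; apply/bigmin_gtP; split=> // -[i j] /= ij.
  by rewrite normr_gt0 subr_eq0 l_inj.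
rewrite mulrC divfK//.
exact: (@bigmin_le_cond _ _ _ _ (i, j) (fun p => p.1 != p.2)
  (fun p => `|l p.1 - l p.2|)).
Qed.

(** The matrix called H in the statement of the theorem. *)
Definition inv_gaps (R : realType) n (L : 'M[R]_n) : 'M[R]_n :=
  \matrix_(i, j) (if i != j then (L j j - L i i)^-1 else 0).

Lemma diag_eigh_expansion (R : realType) n (L : 'M[R]_n) :
  is_diag_mx L -> (forall i j, i != j -> L i i != L j j) ->
  exists K d : R, [/\ 0 <= K, 0 < d & forall E, E^T = E -> `|E| < d ->
    exists M W, [/\ is_eigh (L + E) M W,
      `|M - L - hadamard 1%:M E| <= K * `|E| ^+ 2 &
      `|W - 1%:M - hadamard (inv_gaps L) E| <= K * `|E| ^+ 2]].
Proof.
move=> Ldiag /uniform_gap[e e0 gap].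
have [K K0 est] := eigenrow_estimates n e0.
have : \forall B \near L, forall i,
    exists2 mu, `|mu - L i i| < e & eigenvalue B mu.
  by apply: near_diag_eigenvalues => // i j /gap; lra.
move=> /nbhs_normP[r /= r0 evP].
(* The bound 1 is the one under which [eigenrow_estimates] applies. *)
have d0 : 0 < Num.min r 1 by rewrite lt_min r0 ltr01.
exists K, (Num.min r 1); split=> // E Esym; rewrite lt_min => /andP[Er E1].
have [mu muP] : exists mu : 'rV[R]_n, forall i,
    `|mu 0 i - L i i| < e /\ eigenvalue (L + E) (mu 0 i).
  have /evP evLE : ball_ Num.norm L r (L + E).
    by rewrite /ball_ /= opprD addrA subrr sub0r normrN.
  have /choice[mu muP] : forall i, exists x : R,
      `|x - L i i| < e /\ eigenvalue (L + E) x.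
    by move=> i; have [x xL xev] := evLE i; exists x.
  by exists (\row_i mu i) => i; rewrite mxE; exact: muP.
have LEsym : (L + E)^T = L + E.
  rewrite linearD /= Esym; congr (_ + _); apply/matrixP => i j; rewrite mxE.
  have [->//|ij] := eqVneq i j.
  by rewrite !(is_diag_mxP Ldiag)// eq_sym.
have mu_inj i j : i != j -> mu 0 i != mu 0 j.
  move=> ij; apply/eqP => muij; have := gap _ _ ij.
  have [mui _] := muP i; have [muj _] := muP j; rewrite -muij in muj.
  have -> : L i i - L j j = (mu 0 i - L j j) - (mu 0 i - L i i) by ring.
  by have := ler_normB (mu 0 i - L j j) (mu 0 i - L i i); lra.
have [V [VVt VLE V0]] :=
  sym_orthonormal_eigenrows LEsym mu_inj (fun i => proj2 (muP i)).
have [muE diagE offE] := est L E V mu Ldiag gap (ltW E1) VVt VLE V0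
  (fun i => ltW (proj1 (muP i))).
have KE : 0 <= K * `|E| ^+ 2 by rewrite mulr_ge0// sqr_ge0.
exists (diag_mx mu), V^T; split.
- by split; rewrite ?trmxK// ?VLE -?mulmxA ?VVt ?mulmx1 ?diag_mx_is_diag.
- apply: norm_mx_le => // i j; rewrite !mxE; have [<-|ij] := eqVneq i j.
    by rewrite !mulr1n mul1r.
  by rewrite (is_diag_mxP Ldiag)// !mulr0n mul0r !subr0 normr0.
- apply: norm_mx_le => // i j; rewrite !mxE; have [<-|ij] := eqVneq i j.
    by rewrite mul0r subr0.
  rewrite subr0 -[in X in _ * X]Esym mxE; apply: offE; by rewrite eq_sym.
Qed.

(** * Existence of a differentiable branch *)

(** The common form of the differentials of both outputs: with P = H = 1 it is
    the diagonal part of Q^T E Q, which is the differential of the eigenvalues;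
    with P = Q and H the matrix of inverse gaps it is the differential of the
    eigenvectors. *)
Definition masked_conj (R : realType) n (P H Q E : 'M[R]_n) : 'M[R]_n :=
  P *m hadamard H (Q^T *m E *m Q).

Lemma masked_conj_is_linear (R : realType) n (P H Q : 'M[R]_n) :
  linear (masked_conj P H Q).
Proof.
move=> a E F; rewrite /masked_conj scalemxAr -mulmxDr; congr (_ *m _).
rewrite mulmxDr mulmxDl -scalemxAr -scalemxAl.
by apply/matrixP => i j; rewrite !mxE; ring.
Qed.

HB.instance Definition _ (R : realType) n (P H Q : 'M[R]_n) :=
  GRing.isLinear.Build R _ _ *:%R (masked_conj P H Q)
    (masked_conj_is_linear P H Q).

Lemma sym_differential_of_quadratic (R : realType) n (f : 'M[R]_n -> 'M[R]_n)
    (A : 'M[R]_n) (df : {linear 'M[R]_n -> 'M[R]_n}) (K d : R) :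
  0 <= K -> 0 < d ->
  (forall E, E^T = E -> `|E| < d ->
    `|f (A + E) - f A - df E| <= K * `|E| ^+ 2) ->
  sym_differential f A df.
Proof.
move=> K0 d0 fP; apply/eqoP => e e0.
suff : \forall E \near (0 : 'M[R]_n), E^T = E ->
    `|f (A + E) - f A - df E| <= e * `|E| by [].
apply/nbhs_norm0P; exists (Num.min d (e / (K + 1))) => /=.
  by rewrite lt_min d0 divr_gt0//; lra.
move=> E /=; rewrite lt_min => /andP[Ed Ee] Esym.
apply: (le_trans (fP _ Esym Ed)).
rewrite expr2 mulrA ler_wpM2r//.
move: Ee; rewrite ltr_pdivlMr; last lra.
by have := normr_ge0 E; nra.
Qed.

(** Writing B = A + E, Q^T B Q = L + S with S = Q^T E Q and |S| = O(|E|), an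
    eigendecomposition (M, W) of L + S gives the eigendecomposition (M, Q W) of
    B, and the second-order expansion in S becomes one in E.  The expansion with
    E = 0 forces the chosen decomposition at A to be (L, Q) itself. *)
Lemma eigh_branch_exists (R : realType) n (A L Q : 'M[R]_n) :
  is_eigh A L Q -> (forall i j, i != j -> L i i != L j j) ->
  exists fL fQ dL dQ, @eigh_branch R n A L Q fL fQ dL dQ.
Proof.
move=> [Asym QAQ QtQ Ldiag] distinct.
have QQt : Q *m Q^T = 1%:M by exact: mulmx1C.
have [K [d [K0 d0 expand]]] := diag_eigh_expansion Ldiag distinct.
pose C := n%:R * n%:R * `|Q^T| * `|Q|.
have C0 : 0 <= C by rewrite !mulr_ge0.
pose S E := Q^T *m E *m Q.
have SC E : `|S E| <= C * `|E|.
  apply: (le_trans (norm_mulmx_le _ _)).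
  rewrite /C -!mulrA ler_wpM2l// !mulrA mulrAC ler_wpM2r//.
  exact: norm_mulmx_le.
(* C + 1 rather than C, since C vanishes in dimension 0. *)
pose r := d / (C + 1).
have r0 : 0 < r by rewrite divr_gt0//; lra.
have Sd E : `|E| < r -> `|S E| < d.
  rewrite ltr_pdivlMr; last lra.
  by move=> h; have := SC E; have := normr_ge0 E; nra.
pose good E (p : 'M[R]_n * 'M[R]_n) := [/\ is_eigh (A + E) p.1 (Q *m p.2),
  `|p.1 - L - hadamard 1%:M (S E)| <= K * `|S E| ^+ 2 &
  `|p.2 - 1%:M - hadamard (inv_gaps L) (S E)| <= K * `|S E| ^+ 2].
have [F goodF] : exists F, forall E, E^T = E -> `|E| < r -> good E (F E).
  suff /choice[F FP] : forall E, exists p, E^T = E -> `|E| < r -> good E p.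
    by exists F.
  move=> E; have [[Esym Er]|nE] := pselect (E^T = E /\ `|E| < r); last first.
    by exists (0, 0) => Esym Er; exfalso; exact: nE.
  have SEsym : (S E)^T = S E by rewrite /S !trmx_mul trmxK Esym mulmxA.
  have [M [W [[_ WW WtW Mdiag] ML W1]]] := expand _ SEsym (Sd _ Er).
  exists (M, W) => _ _; split=> //=; split=> //.
  - by rewrite linearD /= Asym Esym.
  - by rewrite -WW -QAQ /S -mulmxDl -mulmxDr trmx_mul !mulmxA.
  - by rewrite trmx_mul !mulmxA -(mulmxA W^T) QtQ mulmx1.
have S0 : S 0 = 0 by rewrite /S mulmx0 mul0mx.
have had0 H : hadamard H 0 = 0 :> 'M[R]_n.
  by apply/matrixP => i j; rewrite !mxE mulr0.
have [FL FQ] : (F 0).1 = L /\ (F 0).2 = 1%:M.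
  have [_] : good 0 (F 0) by apply: goodF; rewrite ?linear0 ?normr0.
  rewrite S0 !had0 !subr0 normr0 expr0n mulr0 !normr_le0 !subr_eq0.
  by move=> /eqP-> /eqP->.
exists (fun B => (F (B - A)).1), (fun B => Q *m (F (B - A)).2).
exists (masked_conj 1%:M 1%:M Q), (masked_conj Q (inv_gaps L) Q).
have SK E : K * `|S E| ^+ 2 <= K * C ^+ 2 * `|E| ^+ 2.
  rewrite -mulrA ler_wpM2l// -exprMn ler_pXn2r ?nnegrE//.
  exact: mulr_ge0.
split.
- by rewrite subrr FL FQ mulmx1.
- apply/nbhs_normP; exists r => // B /=; rewrite /ball_ /= distrC => Br Bsym.
  have [] // := goodF (B - A); first by rewrite linearB /= Bsym Asym.
  by rewrite addrC subrK.
- apply: (@sym_differential_of_quadratic _ _ _ _ _ (K * C ^+ 2) r) => //.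
    by rewrite mulr_ge0// sqr_ge0.
  move=> E Esym Er; rewrite /= subrr [A + E - A]addrC addKr FL.
  have [_ h _] := goodF E Esym Er.
  by rewrite /= /masked_conj mul1mx; apply: (le_trans h).
- apply: (@sym_differential_of_quadratic _ _ _ _ _
    (n%:R * `|Q| * (K * C ^+ 2)) r) => //.
    by rewrite !mulr_ge0// sqr_ge0.
  move=> E Esym Er; rewrite /= subrr [A + E - A]addrC addKr FQ.
  have [_ _ h] := goodF E Esym Er.
  rewrite /= /masked_conj -!mulmxBr; apply: (le_trans (norm_mulmx_le _ _)).
  by rewrite -[leRHS]mulrA ler_wpM2l ?mulr_ge0//; apply: (le_trans h).
Qed.

(** * The differentials along any branch *)

Lemma sym_differential_quotient (R : realType) n (f : 'M[R]_n -> 'M[R]_n)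
    (A : 'M[R]_n) (df : {linear 'M[R]_n -> 'M[R]_n}) (E : 'M[R]_n) i j :
  sym_differential f A df -> E^T = E ->
  (t^-1 *: (f (A + t *: E) - f A)) i j @[t --> (0 : R)^'] --> df E i j.
Proof.
move=> /eqoP fdf Esym; apply/cvgrPdist_le => e e0.
have c0 : 0 < `|E| + 1 by rewrite ltr_wpDl.
have e'0 : 0 < e / (`|E| + 1) by rewrite divr_gt0.
have small : \forall X \near (0 : 'M[R]_n), X^T = X ->
   `|f (A + X) - f A - df X| <= e / (`|E| + 1) * `|X| by exact: fdf.
have small_t := nbhs_dnbhs (near0Z E small).
near=> t.
have t0 : t != 0 by near: t; exact: nbhs_dnbhs_neq.
have ft : `|f (A + t *: E) - f A - df (t *: E)| <= e / (`|E| + 1) * `|t *: E|.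
  have tEsym : (t *: E)^T = t *: E by rewrite linearZ /= Esym.
  by apply: (_ : (t *: E)^T = t *: E -> _); [near: t|].
have -> : df E i j - (t^-1 *: (f (A + t *: E) - f A)) i j =
    - (t^-1 *: (f (A + t *: E) - f A - df (t *: E))) i j.
  by rewrite linearZ /= !mxE; field.
rewrite normrN; apply: (le_trans (norm_mx_entry _ _ _)).
rewrite normrZ normfV ler_pdivrMl ?normr_gt0//.
apply: (le_trans ft); rewrite normrZ mulrCA ler_wpM2l//.
rewrite mulrAC ler_pdivrMr// ler_wpM2l ?(ltW e0)//; lra.
Unshelve. all: by end_near. Qed.

Lemma cvg_mulmx_entry (R : realType) T (F : set_system T) (FF : Filter F)
    m n p (f : T -> 'M[R]_(m, n)) (g : T -> 'M[R]_(n, p))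
    (M : 'M[R]_(m, n)) (P : 'M[R]_(n, p)) :
  (forall i j, f t i j @[t --> F] --> M i j) ->
  (forall i j, g t i j @[t --> F] --> P i j) ->
  forall i j, (f t *m g t) i j @[t --> F] --> (M *m P) i j.
Proof.
move=> fM gP i j; rewrite mxE; under eq_fun do rewrite mxE.
apply: (@cvg_big R _ +%R 0 xpredT add_continuous) => k _.
exact: cvgM.
Qed.

(** The product rule for the defining equations, obtained by writing the values
    of the branch at A + tE as Q + tG and L + tK with G, K the difference
    quotients, dividing the equations by t and letting t tend to 0. *)
Lemma eigh_branch_differential (R : realType) n (A L Q : 'M[R]_n)
    (fL fQ : 'M[R]_n -> 'M[R]_n) (dL dQ : {linear 'M[R]_n -> 'M[R]_n})
    (E : 'M[R]_n) :
  A^T = A -> eigh_branch A L Q fL fQ dL dQ -> E^T = E ->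
  [/\ (dQ E)^T *m Q + Q^T *m dQ E = 0,
      dL E = (dQ E)^T *m A *m Q + Q^T *m E *m Q + Q^T *m A *m dQ E
    & is_diag_mx (dL E)].
Proof.
move=> Asym [[fLA fQA] branchP dfL dfQ] Esym.
have [_ QAQ QtQ Ldiag] : is_eigh A L Q.
  by have := nbhs_singleton branchP; rewrite /= fLA fQA; exact.
pose G t := t^-1 *: (fQ (A + t *: E) - Q).
pose K t := t^-1 *: (fL (A + t *: E) - L).
have Gcvg i j : G t i j @[t --> (0 : R)^'] --> dQ E i j.
  by rewrite /G -fQA; exact: sym_differential_quotient.
have Kcvg i j : K t i j @[t --> (0 : R)^'] --> dL E i j.
  by rewrite /K -fLA; exact: sym_differential_quotient.
have cst_cvg (X : 'M[R]_n) i j : X i j @[t --> (0 : R)^'] --> X i j.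
  exact: cvg_cst.
have t_cvg : t @[t --> (0 : R)^'] --> (0 : R) by exact: nbhs_dnbhs.
have shift_cvg (X : 'M[R]_n) (Y : R -> 'M[R]_n) (Z : 'M[R]_n) :
    (forall i j, Y t i j @[t --> (0 : R)^'] --> Z i j) ->
  forall i j, (X + t *: Y t) i j @[t --> (0 : R)^'] --> X i j.
  move=> YZ i j; under eq_fun do rewrite !mxE.
  have := cvgD (cvg_cst (X i j)) (cvgM t_cvg (YZ i j)).
  by rewrite mul0r addr0; exact.
have nt0 : \forall t \near (0 : R)^', t != 0 by exact: nbhs_dnbhs_neq.
have fQE t : t != 0 -> fQ (A + t *: E) = Q + t *: G t.
  by move=> t0; rewrite /G scalerA divff// scale1r [Q + _]addrC subrK.
have eigh_t : \forall t \near (0 : R)^',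
    t != 0 /\ is_eigh (A + t *: E) (L + t *: K t) (Q + t *: G t).
  have /nbhs_normP[d d0 AdP] := branchP.
  have small : \forall X \near (0 : 'M[R]_n), `|X| < d by exact: nbhs0_lt.
  apply: filterS2 nt0 (nbhs_dnbhs (near0Z E small)) => t t0 tEd; split=> //.
  rewrite -fQE // /K scalerA divff// scale1r [L + _]addrC subrK.
  apply: AdP; first by rewrite /ball_ /= opprD addrA subrr sub0r normrN.
  by rewrite linearD linearZ /= Asym Esym.
have unique (f g : R -> 'M[R]_n) (X Y : 'M[R]_n) :
  (\forall t \near (0 : R)^', f t = g t) ->
  (forall i j, f t i j @[t --> (0 : R)^'] --> X i j) ->
  (forall i j, g t i j @[t --> (0 : R)^'] --> Y i j) -> X = Y.
  move=> fg fX gY; apply/matrixP => i j.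
  apply: (cvg_unique _ (fX i j)) => //.
  apply: cvg_trans (gY i j); apply: near_eq_cvg.
  by apply: filterS fg => t ->.
have GT i j : (G t)^T i j @[t --> (0 : R)^'] --> (dQ E)^T i j.
  by rewrite mxE; under eq_fun do rewrite mxE; exact: Gcvg.
have mulDl (t : R) (X Y M P : 'M[R]_n) :
    (X + t *: Y) *m M *m P = X *m M *m P + t *: (Y *m M *m P).
  by rewrite !mulmxDl -!scalemxAl.
have mulDm (t : R) (X Y M P : 'M[R]_n) :
    X *m (M + t *: Y) *m P = X *m M *m P + t *: (X *m Y *m P).
  by rewrite mulmxDr mulmxDl -scalemxAr -scalemxAl.
have mulDr (t : R) (X Y M : 'M[R]_n) :
    X *m (M + t *: Y) = X *m M + t *: (X *m Y).
  by rewrite mulmxDr -scalemxAr.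
have trQG t : (Q + t *: G t)^T = Q^T + t *: (G t)^T.
  by rewrite linearD /= linearZ.
have QG i j := shift_cvg Q G (dQ E) Gcvg i j.
have AE i j := shift_cvg A (fun=> E) E (cst_cvg E) i j.
split.
- apply: (unique (fun t => (G t)^T *m (Q + t *: G t) + Q^T *m G t) (fun=> 0)) => [|i j|].
  + apply: filterS eigh_t => t [t0 [_ _ orth _]].
    apply: (scalerI t0); rewrite scaler0 scalerDr scalemxAl scalemxAr.
    move: orth; rewrite trQG mulmxDl [Q^T *m (_ + _)]mulmxDr QtQ.
    by rewrite -addrA addrC => /(canRL (addrK _)); rewrite subrr addrC.
  + rewrite [X in _ --> X]mxE; under eq_fun do rewrite mxE.
    by apply: cvgD; apply: cvg_mulmx_entry.
  + exact: cst_cvg.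
- apply: (unique K (fun t => (G t)^T *m (A + t *: E) *m (Q + t *: G t)
    + Q^T *m E *m (Q + t *: G t) + Q^T *m A *m G t)) => // [|i j].
  + apply: filterS eigh_t => t [t0 [_ diag _ _]].
    apply: (scalerI t0); apply: (addrI L); rewrite -diag trQG.
    rewrite mulDl (mulDm _ Q^T) (mulDr _ (Q^T *m A)) QAQ !scalerDr -!addrA.
    by congr (_ + _); rewrite addrCA [RHS]addrC -addrA.
  + rewrite mxE [X in X + _]mxE; under eq_fun do rewrite mxE [X in X + _]mxE.
    apply: cvgD; first apply: cvgD.
    * by apply: cvg_mulmx_entry => //; exact: cvg_mulmx_entry.
    * by apply: cvg_mulmx_entry => //; exact: cst_cvg.
    * by apply: cvg_mulmx_entry => //; exact: cst_cvg.
- apply/is_diag_mxP => i j ij.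
  apply: (cvg_unique _ (Kcvg i j)) => //.
  have zero_cvg : (0 : R) @[_ --> (0 : R)^'] --> (0 : R) by exact: cvg_cst.
  apply: cvg_trans zero_cvg; apply: near_eq_cvg.
  apply: filterS eigh_t => t [t0 [_ _ _ /is_diag_mxP/(_ _ _ ij)]].
  rewrite mxE (is_diag_mxP Ldiag)// add0r mxE => /eqP.
  by rewrite mulf_eq0 (negbTE t0) => /eqP.
Qed.

(** Q^T dQ = X is antisymmetric, so its diagonal vanishes, and
    dL_ij = S_ij + (L_ii - L_jj) X_ij with dL diagonal determines its other
    entries. *)
Lemma eigh_branch_differentialE (R : realType) n (A L Q : 'M[R]_n)
    (fL fQ : 'M[R]_n -> 'M[R]_n) (dL dQ : {linear 'M[R]_n -> 'M[R]_n})
    (E : 'M[R]_n) :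
  is_eigh A L Q -> (forall i j, i != j -> L i i != L j j) ->
  eigh_branch A L Q fL fQ dL dQ -> E^T = E ->
  dL E = masked_conj 1%:M 1%:M Q E /\ dQ E = masked_conj Q (inv_gaps L) Q E.
Proof.
move=> [Asym QAQ QtQ Ldiag] distinct branch Esym.
have [orth dLE dLdiag] := eigh_branch_differential Asym branch Esym.
have QQt : Q *m Q^T = 1%:M by exact: mulmx1C.
pose S := Q^T *m E *m Q; pose X := Q^T *m dQ E.
have XT : X^T = - X.
  by rewrite /X trmx_mul trmxK; apply/eqP; rewrite -addr_eq0 orth.
have XN i j : X j i = - X i j by have /matrixP/(_ i j) := XT; rewrite !mxE.
have AQ : A *m Q = Q *m L by rewrite -QAQ !mulmxA QQt mul1mx.
have QA : Q^T *m A = L *m Q^T by rewrite -QAQ -!mulmxA QQt mulmx1.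
have {}dLE : dL E = S + (L *m X - X *m L).
  rewrite dLE -mulmxA AQ QA mulmxA -[Q in (dQ E)^T *m Q]trmxK -trmx_mul -/X XT.
  rewrite -[L *m Q^T *m dQ E]mulmxA -/X -/S mulNmx.
  by rewrite [- _ + S]addrC -addrA [- _ + _]addrC.
have entry i j : dL E i j = S i j + (L i i - L j j) * X i j.
  have /diag_mxP[l Ll] := Ldiag.
  rewrite dLE Ll mul_diag_mx mul_mx_diag !mxE !eqxx !mulr1n; ring.
split.
- apply/matrixP => i j; rewrite /masked_conj mul1mx [RHS]mxE [1%:M i j]mxE -/S.
  have [<-|ij] := eqVneq i j; first by rewrite entry subrr mul0r addr0 mul1r.
  by rewrite (is_diag_mxP dLdiag)// mul0r.
- rewrite /masked_conj -/S.
  suff <- : X = hadamard (inv_gaps L) S by rewrite /X mulmxA QQt mul1mx.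
  apply/matrixP => i j; rewrite [RHS]mxE [inv_gaps _ _ _]mxE.
  have [<-|ij] := eqVneq i j; first by rewrite /= mul0r; have := XN i i; lra.
  have Lij : L j j - L i i != 0 by rewrite subr_eq0 eq_sym distinct.
  have := entry i j; rewrite (is_diag_mxP dLdiag)// => h.
  apply: (mulfI Lij); rewrite mulVKf//=; lra.
Qed.

(** * Adjoints for the trace pairing *)

Lemma mxtrace_hadamard (R : realType) n (H X Y : 'M[R]_n) :
  \tr (X^T *m hadamard H Y) = \tr ((hadamard H X)^T *m Y).
Proof.
apply: eq_bigr => i _; rewrite !mxE; apply: eq_bigr => j _.
by rewrite !mxE; ring.
Qed.

Lemma mxtrace_masked_conj (R : realType) n (P H Q X E : 'M[R]_n) :
  \tr (X^T *m masked_conj P H Q E) =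
  \tr ((Q *m hadamard H (P^T *m X) *m Q^T)^T *m E).
Proof.
rewrite /masked_conj mulmxA -[P in X^T *m P]trmxK -trmx_mul mxtrace_hadamard.
by rewrite !trmx_mul trmxK -!mulmxA [RHS]mxtrace_mulC !mulmxA.
Qed.

Theorem proposition6 (R : realType) (N : nat)
    (A Q Lambda Qbar Lambdabar H Abar : 'M[R]_N)
    (heigh : is_eigh A Lambda Q)
    (hdistinct : forall i j : 'I_N, i != j -> Lambda i i != Lambda j j)
    (hLambdabar : is_diag_mx Lambdabar)
    (hH : H = \matrix_(i, j)
                (if i != j then (Lambda j j - Lambda i i)^-1 else 0))
    (hAbar : Abar = Q *m (Lambdabar + hadamard H (Q^T *m Qbar)) *m Q^T) :
  is_eigh_pullback A Lambda Q Lambdabar Qbar Abar.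
Proof.
split; first exact: eigh_branch_exists.
move=> fL fQ dL dQ branch E Esym.
have [-> ->] := eigh_branch_differentialE heigh hdistinct branch Esym.
(* A diagonal Lambdabar is its own mask by 1, as in the adjoint of dLambda. *)
have diagE : hadamard 1%:M Lambdabar = Lambdabar.
  apply/matrixP => i j; rewrite !mxE; have [<-|ij] := eqVneq i j.
    by rewrite mul1r.
  by rewrite (is_diag_mxP hLambdabar)// mul0r.
rewrite !mxtrace_masked_conj trmx1 mul1mx diagE -mxtraceD -mulmxDl -linearD.
by rewrite -mulmxDl -mulmxDr hAbar hH.
Qed.
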